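(* Let $d\ge 1$, let $M\in\mathbb{R}^{d\times d}$ satisfy $M+M^\top\succeq 0$, let $q\in\mathbb{R}^d$, and let $\mathcal{C}\subseteq\mathbb{R}^d$ be a nonempty closed convex cone. Let $\mathcal{C}_+=\mathcal{C}\times\mathbb{R}_+$ and $\mathcal{C}_+^*=\mathcal{C}^*\times\mathbb{R}_+$. Set $r=(I+M)^{-1}q$, and from an initial point $w^0=(\mu^0,\eta^0)\in\mathbb{R}^d\times\mathbb{R}$ with $\eta^0>0$ define, for $k=0,1,2,\ldots$, $$p^k=(I+M)^{-1}\mu^k,\qquad \tilde\tau^{k+1}=\frac{-b^k+\sqrt{(b^k)^2-4ac^k}}{2a},\qquad \tilde z^{k+1}=p^k-r\tilde\tau^{k+1},$$ where $a=1+r^\top r$, $b^k=r^\top\mu^k-2r^\top p^k-\eta^k$, $c^k=(p^k)^\top(p^k-\mu^k)$, and $$z^{k+1}=\Pi_{\mathcal{C}}(2\tilde z^{k+1}-\mu^k),\qquad \tau^{k+1}=\max(0,\,2\tilde\tau^{k+1}-\eta^k),$$ $$\mu^{k+1}=\mu^k+z^{k+1}-\tilde z^{k+1},\qquad \eta^{k+1}=\eta^k+\tau^{k+1}-\tilde\tau^{k+1}.$$ Write $\tilde u^k=(\tilde z^k,\tilde\tau^k)$, $u^k=(z^k,\tau^k)$, $w^k=(\mu^k,\eta^k)$ and $v^{k+1}=u^{k+1}+w^k-2\tilde u^{k+1}$. Then: (i) The iteration is well defined (the quantity under the square root is always nonnegative), and for every $k\ge 0$, $\tilde u^{k+1}=(I+\mathcal{Q})^{-1}w^k$,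 where $\mathcal{Q}$ is the operator defined in the context. (ii) For every $k\ge 1$: $u^k\in\mathcal{C}_+$, $v^k\in\mathcal{C}_+^*$ and $(u^k)^\top v^k=0$. (iii) The sequences $u^k$, $v^k$ and $w^k$ converge, $\|u^k-\tilde u^k\|\to 0$, and the limits $u^\star=(z^\star,\tau^\star)$ of $u^k$ and $v^\star=(\omega^\star,\kappa^\star)$ of $v^k$ satisfy $v^\star\in\mathcal{Q}(u^\star)$, $u^\star\in\mathcal{C}_+$, $v^\star\in\mathcal{C}_+^*$, $(u^\star)^\top v^\star=0$. In particular at most one of $\tau^\star,\kappa^\star$ is positive. If $\tau^\star>0$ then $z^\star/\tau^\star$ is a solution of $\mathrm{LCP}(M,q,\mathcal{C})$; if $\kappa^\star>0$ then $z^\star$ is a certificate of infeasibility for $\mathrm{LCP}(M,q,\mathcal{C})$. (iv) If $\mathrm{LCP}(M,q,\mathcal{C})$ has a solution or a certificate of infeasibility, and the iteration is initialized with $\mu^0=0$, $\eta^0=1$, then $\inf_{k\ge 0}\|w^k\|_2>0$.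
   Context: $\mathbb{R}_+$ and $\mathbb{R}_{++}$ are the nonnegative and strictly positive reals; $\mathcal{C}^*=\{w\mid w^\top z\ge 0\ \text{for all } z\in\mathcal{C}\}$ is the dual cone; $\Pi_{\mathcal{C}}$ is the Euclidean projection onto $\mathcal{C}$; $M+M^\top\succeq 0$ means that $M+M^\top$ is positive semidefinite. A solution of the linear complementarity problem $\mathrm{LCP}(M,q,\mathcal{C})$ is a $z\in\mathcal{C}$ with $Mz+q\in\mathcal{C}^*$ and $z^\top(Mz+q)=0$. A certificate of infeasibility for $\mathrm{LCP}(M,q,\mathcal{C})$ is a $\lambda\in\mathcal{C}$ with $M\lambda\in\mathcal{C}^*$, $\lambda^\top M\lambda=0$ and $\lambda^\top q<0$. The operator $\mathcal{Q}$ on $\mathbb{R}^{d+1}=\mathbb{R}^d\times\mathbb{R}$ is the set-valued operator with domain $(\mathbb{R}^d\times\mathbb{R}_{++})\cup\{(z,0)\mid z^\top Mz=0\}$ given by $\mathcal{Q}(z,\tau)=\{(Mz+q\tau,\,-z^\top Mz/\tau-z^\top q)\}$ for $\tau>0$, and $\mathcal{Q}(z,0)=\{(Mz,\kappa)\mid \kappa\le -z^\top q\}$ when $z^\top Mz=0$ (and $\mathcal{Q}=\emptyset$ elsewhere). The resolvent $(I+\mathcal{Q})^{-1}$ is the operator $\{(x,y)\mid x\in y+\mathcal{Q}(y)\}$; writing $y=(I+\mathcal{Q})^{-1}x$ asserts that $y$ is the unique point with $x\in y+\mathcal{Q}(y)$. Vectors $(z,\tau)$ are regarded as column vectors in $\mathbb{R}^{d+1}$.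 *)

(* Defs.v *)
(* Vectors of R^n are columns 'cV[R]_n. *)
From HB Require Import structures.
From mathcomp Require Import all_boot all_order all_algebra.
From mathcomp Require Import all_classical all_reals all_analysis.

Set Implicit Arguments.
Unset Strict Implicit.
Unset Printing Implicit Defensive.

Import Order.TTheory GRing.Theory Num.Theory.
Import numFieldNormedType.Exports.

Local Open Scope classical_set_scope.
Local Open Scope ring_scope.

Section Euclidean.
Context {R : realType}.

Definition dot {n : nat} (x y : 'cV[R]_n) : R := (x^T *m y) 0 0.

(* The library norm on matrices is the sup norm, hence this definition. *)
Definition enorm {n : nat} (x : 'cV[R]_n) : R := Num.sqrt (dot x x).

Definition psdmx {n : nat} (A : 'M[R]_n) : Prop :=
  A^T = A /\ forall x : 'cV[R]_n, 0 <= dot x (A *m x).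

(* Closure under positive scaling only: a nonempty closed set with this
   property automatically contains the origin. *)
Definition is_cone {n : nat} (C : set 'cV[R]_n) : Prop :=
  forall (t : R) x, 0 < t -> C x -> C (t *: x).

Definition dual_cone {n : nat} (C : set 'cV[R]_n) : set 'cV[R]_n :=
  [set w | forall z, C z -> 0 <= dot w z].

Definition nearest_point {n : nat} (C : set 'cV[R]_n) (x : 'cV[R]_n) :
    set 'cV[R]_n :=
  [set y | C y /\ forall y', C y' -> enorm (x - y) <= enorm (x - y')].

(* Takes the junk value 0 when there is no nearest point. *)
Definition proj {n : nat} (C : set 'cV[R]_n) (x : 'cV[R]_n) : 'cV[R]_n :=
  xget 0 (nearest_point C x).

Definition vec {d : nat} (z : 'cV[R]_d) (t : R) : 'cV[R]_(d + 1) :=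
  col_mx z t%:M.
Definition zpart {d : nat} (x : 'cV[R]_(d + 1)) : 'cV[R]_d := usubmx x.
Definition tpart {d : nat} (x : 'cV[R]_(d + 1)) : R := dsubmx x 0 0.

(* C * R_+ *)
Definition cone_plus {d : nat} (C : set 'cV[R]_d) : set 'cV[R]_(d + 1) :=
  [set x | C (zpart x) /\ 0 <= tpart x].

Definition resolvent {n : nat} (T : 'cV[R]_n -> set 'cV[R]_n) (x : 'cV[R]_n) :
    set 'cV[R]_n :=
  [set y | exists2 s, T y s & x = y + s].

End Euclidean.

Section Problem.
Context {R : realType} {d : nat}.
Variables (M : 'M[R]_d) (q : 'cV[R]_d) (C : set 'cV[R]_d).

Definition lcp_solution (z : 'cV[R]_d) : Prop :=
  [/\ C z, dual_cone C (M *m z + q) & dot z (M *m z + q) = 0].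

Definition lcp_infeasibility_certificate (l : 'cV[R]_d) : Prop :=
  [/\ C l, dual_cone C (M *m l), dot l (M *m l) = 0 & dot l q < 0].

Definition Qop (x : 'cV[R]_(d + 1)) : set 'cV[R]_(d + 1) :=
  let z := zpart x in let t := tpart x in
  [set s |
    (0 < t /\ s = vec (M *m z + t *: q) (- dot z (M *m z) / t - dot z q)) \/
    [/\ t = 0, dot z (M *m z) = 0 &
        exists2 kappa : R, kappa <= - dot z q & s = vec (M *m z) kappa]].

(* invmx is the identity on singular matrices; that 1%:M + M is invertible is
   part of the well-definedness of the iteration. *)
Definition rvec : 'cV[R]_d := invmx (1%:M + M) *m q.
Definition pvec (mu : 'cV[R]_d) : 'cV[R]_d := invmx (1%:M + M) *m mu.

Definition acoef : R := 1 + dot rvec rvec.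
Definition bcoef (mu : 'cV[R]_d) (eta : R) : R :=
  dot rvec mu - 2 * dot rvec (pvec mu) - eta.
Definition ccoef (mu : 'cV[R]_d) : R := dot (pvec mu) (pvec mu - mu).

Definition discr (w : 'cV[R]_(d + 1)) : R :=
  bcoef (zpart w) (tpart w) ^+ 2 - 4 * acoef * ccoef (zpart w).

(* One iteration, from w = (mu^k, eta^k): utilde_next w, u_next w and w_next w
   are the (k+1)-st iterates of the three sequences. *)
Definition utilde_next (w : 'cV[R]_(d + 1)) : 'cV[R]_(d + 1) :=
  let mu := zpart w in let eta := tpart w in
  let tau := (- bcoef mu eta + Num.sqrt (discr w)) / (2 * acoef) in
  vec (pvec mu - tau *: rvec) tau.

Definition u_next (w : 'cV[R]_(d + 1)) : 'cV[R]_(d + 1) :=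
  let mu := zpart w in let eta := tpart w in
  vec (proj C (2 *: zpart (utilde_next w) - mu))
      (Num.max 0 (2 * tpart (utilde_next w) - eta)).

Definition w_next (w : 'cV[R]_(d + 1)) : 'cV[R]_(d + 1) :=
  w + u_next w - utilde_next w.

Variable w0 : 'cV[R]_(d + 1).

Definition wseq (k : nat) : 'cV[R]_(d + 1) := iter k w_next w0.

(* The next three sequences are meaningful for k >= 1 only. *)
Definition utilde (k : nat) : 'cV[R]_(d + 1) := utilde_next (wseq k.-1).
Definition useq (k : nat) : 'cV[R]_(d + 1) := u_next (wseq k.-1).
Definition vseq (k : nat) : 'cV[R]_(d + 1) :=
  useq k + wseq k.-1 - 2 *: utilde k.

End Problem.

(* Main.v *)
(* The iteration is Douglas-Rachford splitting for 0 in Q + N_{C x R_+}.  Q is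
   monotone, and its resolvent at w reduces to a quadratic equation for tau with
   positive leading and nonpositive constant coefficient; the larger root gives
   the unique point of the resolvent.  Call (us, vs) a solution when vs is in
   Q us and us, vs are complementary for the cone and its dual.  For every
   solution, monotonicity and complementarity give
     |w' - (us + vs)|^2 + |u - utilde|^2 <= |w - (us + vs)|^2.
   As (0, 0) is a solution, the iterates are bounded and u - utilde tends to 0; a
   cluster point p yields the solution (J p, p - J p), J the resolvent of Q, so
   Fejer monotonicity towards p forces convergence to p.  Solutions form a cone,
   hence the inner product of w^k with us + vs never drops below its initial
   value, which is positive at w^0 = (0, 1) for the solution built from an LCP
   solution or a certificate. *)
Require Import Defs.
From HB Require Import structures.
From mathcomp Require Import all_boot all_order all_algebra.
From mathcomp Require Import all_classical all_reals all_analysis.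
From mathcomp Require Import ring lra.

Set Implicit Arguments.
Unset Strict Implicit.
Unset Printing Implicit Defensive.

Import Order.TTheory GRing.Theory Num.Theory.
Import numFieldNormedType.Exports.

Local Open Scope classical_set_scope.
Local Open Scope ring_scope.

(** * The Euclidean inner product *)

Section Dot.
Context {R : realType} {n : nat}.
Implicit Types x y z : 'cV[R]_n.

Lemma dotE x y : dot x y = \sum_i x i 0 * y i 0.
Proof. by rewrite /dot mxE; apply: eq_bigr => i _; rewrite mxE. Qed.

Lemma dotC x y : dot x y = dot y x.
Proof. by rewrite !dotE; apply: eq_bigr => i _; rewrite mulrC. Qed.

Lemma dotDl x y z : dot (x + y) z = dot x z + dot y z.
Proof. by rewrite /dot linearD mulmxDl mxE. Qed.

Lemma dotDr x y z : dot z (x + y) = dot z x + dot z y.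
Proof. by rewrite /dot mulmxDr mxE. Qed.

Lemma dotNl x z : dot (- x) z = - dot x z.
Proof. by rewrite /dot linearN mulNmx mxE. Qed.

Lemma dotNr x z : dot z (- x) = - dot z x.
Proof. by rewrite /dot mulmxN mxE. Qed.

Lemma dotZl (t : R) x z : dot (t *: x) z = t * dot x z.
Proof. by rewrite /dot linearZ -scalemxAl mxE. Qed.

Lemma dotZr (t : R) x z : dot z (t *: x) = t * dot z x.
Proof. by rewrite /dot -scalemxAr mxE. Qed.

Lemma dot0l z : dot 0 z = 0.
Proof. by rewrite /dot trmx0 mul0mx mxE. Qed.

Lemma dot0r z : dot z 0 = 0.
Proof. by rewrite dotC dot0l. Qed.

Definition dot_linE :=
  (dotDl, dotDr, dotNl, dotNr, dotZl, dotZr, dot0l, dot0r).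

Lemma dot_mulmxr (A : 'M[R]_n) x y : dot x (A *m y) = dot (A^T *m x) y.
Proof. by rewrite /dot trmx_mul trmxK mulmxA. Qed.

Lemma sqr_entry_le_dot x i : x i 0 ^+ 2 <= dot x x.
Proof.
rewrite dotE (bigD1 i) //= expr2 lerDl.
by apply: sumr_ge0 => j _; rewrite -expr2 sqr_ge0.
Qed.

Lemma dot_ge0 x : 0 <= dot x x.
Proof. by rewrite dotE; apply: sumr_ge0 => j _; rewrite -expr2 sqr_ge0. Qed.

Lemma dot_le0_eq0 x : dot x x <= 0 -> x = 0.
Proof.
move=> x0; apply/colP => i; rewrite mxE; apply/eqP; rewrite -sqrf_eq0 eq_le.
by rewrite sqr_ge0 (le_trans (sqr_entry_le_dot x i)).
Qed.

Lemma enorm_le x y : (enorm x <= enorm y) = (dot x x <= dot y y).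
Proof. by rewrite /enorm ler_sqrt ?dot_ge0. Qed.

Lemma sqr_enorm x : enorm x ^+ 2 = dot x x.
Proof. by rewrite sqr_sqrtr ?dot_ge0. Qed.

Lemma entry_le_enorm x i : `|x i 0| <= enorm x.
Proof. by rewrite -sqrtr_sqr ler_sqrt ?dot_ge0 ?sqr_entry_le_dot. Qed.

Lemma normr_le_enorm x : `|x| <= enorm x.
Proof.
rewrite /Num.Def.normr/= mx_normrE; apply: bigmax_le; first exact: sqrtr_ge0.
by move=> [i j] _ /=; rewrite (ord1 j) entry_le_enorm.
Qed.

Lemma cauchy_schwarz x y : dot x y <= enorm x * enorm y.
Proof.
have [->|y0] := eqVneq y 0.
  by rewrite dot0r mulr_ge0 ?sqrtr_ge0.
have yy0 : 0 < dot y y.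
  rewrite lt_def dot_ge0 andbT; apply: contra_neq y0 => yy.
  by apply: dot_le0_eq0; rewrite yy.
have [xy0|/ltW xy0] := leP (dot x y) 0.
  by rewrite (le_trans xy0) // mulr_ge0 ?sqrtr_ge0.
rewrite -[leLHS]ger0_norm // -sqrtr_sqr -sqrtrM ?dot_ge0 //.
rewrite ler_sqrt ?mulr_ge0 ?dot_ge0 //.
(* This squared norm is [dot y y] times the difference of the two sides. *)
have := dot_ge0 (dot y y *: x - dot x y *: y).
rewrite !dot_linE (dotC y x) => h.
have : 0 <= dot y y * (dot x x * dot y y - dot x y ^+ 2) by lra.
by rewrite pmulr_rge0 // subr_ge0.
Qed.

Lemma enormD x y : enorm (x + y) <= enorm x + enorm y.
Proof.
rewrite -ler_sqr ?nnegrE ?addr_ge0 ?sqrtr_ge0 // sqrrD !sqr_enorm.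
by rewrite !dot_linE (dotC y x); have := cauchy_schwarz x y; lra.
Qed.

End Dot.

(** * Limits and compactness for the Euclidean norm *)

Section DotCvg.
Context {R : realType} {n : nat}.

Lemma cvg_dot {T : Type} (F : set_system T) {FF : Filter F}
    (f g : T -> 'cV[R]_n) (a b : 'cV[R]_n) :
  f x @[x --> F] --> a -> g x @[x --> F] --> b ->
  dot (f x) (g x) @[x --> F] --> dot a b.
Proof.
move=> fa gb; rewrite dotE; under eq_fun do rewrite dotE.
apply: cvg_big => [|i _]; first exact: add_continuous.
have coord := @coord_continuous R n 1 i 0.
by apply: cvgM; [exact: (cvg_comp _ _ fa (coord a))|
                 exact: (cvg_comp _ _ gb (coord b))].
Qed.

Lemma cvg_enorm {T : Type} (F : set_system T) {FF : Filter F}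
    (f : T -> 'cV[R]_n) (a : 'cV[R]_n) :
  f x @[x --> F] --> a -> enorm (f x) @[x --> F] --> enorm a.
Proof.
move=> fa.
exact: (cvg_comp _ _ (cvg_dot fa fa) (@sqrt_continuous R (dot a a))).
Qed.

(** The ambient topology is that of the sup norm, which [enorm] dominates. *)
Lemma enorm_cvg0 {T : Type} (F : set_system T) {FF : ProperFilter F}
    (f : T -> 'cV[R]_n) :
  enorm (f x) @[x --> F] --> (0 : R) -> f x @[x --> F] --> (0 : 'cV[R]_n).
Proof.
move=> f0; apply: norm_cvg0.
apply: (squeeze_cvgr _ (cvg_cst 0) f0).
by apply: nearW => x; rewrite normr_ge0 normr_le_enorm.
Qed.

Lemma trmx_continuous m : continuous (fun x : 'M[R]_(m, n) => x^T).
Proof.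
move=> x; apply/(@cvgrPdist_lt _ _ _ _ (nbhs_filter x)) => e e0.
apply: filterS (nbhs_ball_norm x (PosNum e0)) => y /= /(le_lt_trans _); apply.
rewrite -linearB /= {1}/Num.Def.normr/= mx_normrE; apply: bigmax_le => //.
move=> [i j] _ /=; rewrite mxE [leRHS]/Num.Def.normr/= mx_normrE.
exact: (le_bigmax _ _ (j, i)).
Qed.

(** Heine-Borel in [bounded_closed_compact] concerns row vectors, so [A] is written as the image of
    a set of rows under the continuous transposition. *)
Lemma compact_closed_bounded (A : set 'cV[R]_n) (B : R) :
  (forall x, A x -> enorm x <= B) -> closed A -> compact A.
Proof.
move=> AB Acl.
have -> : A = trmx @` [set y : 'rV[R]_n | A y^T].
  apply/seteqP; split => [x Ax|_ [y Ay <-]] //.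
  by exists x^T; rewrite /= ?trmxK.
apply: continuous_compact.
  by apply: continuous_subspaceT; exact: trmx_continuous.
apply: bounded_closed_compact; last first.
  by apply: preimage_closed Acl => x _; exact: trmx_continuous.
exists B; split; first exact: num_real.
move=> C BC y /= /AB yB.
rewrite /Num.Def.normr/= mx_normrE; apply: bigmax_le.
  by rewrite (le_trans (sqrtr_ge0 (dot y^T y^T))) // (le_trans yB) ?ltW.
move=> [i j] _ /=; rewrite (ord1 i).
have := entry_le_enorm y^T j; rewrite mxE => /le_trans; apply.
by rewrite (le_trans yB) ?ltW.
Qed.

(** Compactness of the closed ball gives a cluster point [p]; [f j] picks an index past [j] at
    distance less than 1/(j+1) from [p]. The bound [j <= f j] is all that limits along [f]
    require. *)
Lemma bounded_seq_subseq (w : nat -> 'cV[R]_n) (B : R) :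
  (forall k, enorm (w k) <= B) ->
  exists (p : 'cV[R]_n) (f : nat -> nat),
    (forall j, (j <= f j)%N) /\ (w \o f) @ \oo --> p.
Proof.
move=> wB.
pose A := [set x : 'cV[R]_n | enorm x <= B].
have Acl : closed A.
  apply: (preimage_closed (f := enorm) (D := [set t : R | t <= B])).
    by move=> x _; exact: (@cvg_enorm _ (nbhs x) _ id x cvg_id).
  exact: closed_le.
have Aco : compact A by exact: (@compact_closed_bounded A B).
have [|p [_ clp]] := Aco (w @ \oo) _.
  by exists 0%N => // k _; exact: wB.
have /choice[f fP] : forall j : nat,
    exists k : nat, (j <= k)%N /\ `|p - w k| < j.+1%:R^-1.
  move=> j.
  have j0 : 0 < (j.+1%:R : R)^-1 by rewrite invr_gt0.
  have tail : (w @ \oo) (w @` [set k | (j <= k)%N]).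
    by exists j => // k /= jk; exists k.
  have near_p : nbhs p [set x | `|p - x| < j.+1%:R^-1].
    exact: (nbhs_ball_norm p (PosNum j0)).
  by have [_ [[k /= jk <-] ?]] := clp _ _ tail near_p; exists k.
exists p, f; split; first by move=> j; case: (fP j).
apply/cvgrPdist_lt => e e0.
near=> j.
case: (fP j) => _ /lt_trans; apply.
by near: j; exact: near_infty_natSinv_lt (PosNum e0).
Unshelve. all: by end_near. Qed.

End DotCvg.

(** * Projection onto a closed convex cone *)

Section NearestPoint.
Context {R : realType} {n : nat}.
Variable C : set 'cV[R]_n.

Lemma nearest_point_ex x :
  C !=set0 -> closed C -> exists y, nearest_point C x y.
Proof.
move=> [y0 Cy0] Ccl.
(* Cutting [C] by the ball around [x] through [y0] makes the minimisation compact. *)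
pose A := C `&` [set y | enorm (x - y) <= enorm (x - y0)].
have dist_cont : continuous (fun y : 'cV[R]_n => enorm (x - y)).
  move=> y; apply: (@cvg_enorm _ _ _ (nbhs y) _ (fun z => x - z) (x - y)).
  by apply: cvgB; [exact: cvg_cst|exact: cvg_id].
have Acl : closed A.
  apply: closedI Ccl _.
  apply: (preimage_closed (f := fun y : 'cV[R]_n => enorm (x - y))
                          (D := [set t : R | t <= enorm (x - y0)])).
    by move=> y _; exact: dist_cont.
  exact: closed_le.
have Aco : compact A.
  apply: (@compact_closed_bounded _ _ A (enorm x + enorm (x - y0))) => //.
  move=> y [_ /= yle].
  have -> : y = x + - (x - y) by rewrite opprB addrC subrK.
  apply: (le_trans (enormD _ _)); rewrite lerD2l.
  by rewrite /enorm dotNl dotNr opprK.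
have A0 : A !=set0 by exists y0; split => /=.
have [y /set_mem[Cy yle] ymin] :=
  compact_EVT_min A0 Aco (continuous_subspaceT dist_cont).
exists y; split => // y' Cy'.
have [y'le|/ltW] := leP (enorm (x - y')) (enorm (x - y0)).
  by apply: ymin; rewrite inE.
exact: le_trans.
Qed.

Hypothesis C_convex : convex_set C.

Lemma convex_set_segment (t : R) y y' :
  0 <= t <= 1 -> C y -> C y' -> C (y + t *: (y' - y)).
Proof.
move=> t01 Cy Cy'.
pose k : {i01 R} := Itv01 (proj1 (andP t01)) (proj2 (andP t01)).
have := C_convex k (mem_set Cy') (mem_set Cy).
rewrite inE.
suff -> : y + t *: (y' - y) = conv k (y' : convex_lmodType _) y by [].
by rewrite /conv /= scalerBl scale1r scalerBr addrCA addrC.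
Qed.

Lemma nearest_point_obtuse x y y' :
  nearest_point C x y -> C y' -> dot (x - y) (y' - y) <= 0.
Proof.
move=> [Cy ymin] Cy'; rewrite leNgt; apply/negP => s0.
set s := dot _ _ in s0.
pose D := dot (y' - y) (y' - y).
have D0 : 0 <= D by exact: dot_ge0.
(* Moving by [t] towards [y'] changes the squared distance by -t(2s - tD). This [t] lies in (0, 1]
   and gives tD = s - ts < 2s. *)
pose t := s / (s + D).
have sD : 0 < s + D by rewrite ltr_wpDr.
have t0 : 0 < t by rewrite divr_gt0.
have tE : t * (s + D) = s by rewrite divfK ?gt_eqF.
have t1 : t <= 1 by rewrite ler_pdivrMr // mul1r lerDl.
have t01 : 0 <= t <= 1 by rewrite ltW.
have := ymin _ (convex_set_segment t01 Cy Cy').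
rewrite enorm_le opprD addrA.
have -> : dot (x - y - t *: (y' - y)) (x - y - t *: (y' - y)) =
    dot (x - y) (x - y) - t * (2 * s - t * D).
  rewrite /s /D; move: (x - y) (y' - y) => e g.
  by rewrite !dot_linE (dotC g e); ring.
have : 0 < t * (2 * s - t * D).
  by rewrite mulr_gt0 //; nra.
lra.
Qed.

(** The two obtuse-angle inequalities add up to |y - y'|^2 <= 0. *)
Lemma nearest_point_uniq x y y' :
  nearest_point C x y -> nearest_point C x y' -> y = y'.
Proof.
move=> xy xy'.
have h := nearest_point_obtuse xy xy'.1.
have h' := nearest_point_obtuse xy' xy.1.
apply/subr0_eq/dot_le0_eq0.
move: h h'; rewrite !dot_linE (dotC y' y); lra.
Qed.

Hypothesis C_nonempty : C !=set0.
Hypothesis C_closed : closed C.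

Lemma nearest_point_exu x : exists! y, nearest_point C x y.
Proof.
have [y xy] := nearest_point_ex x C_nonempty C_closed.
by exists y; split => // y'; exact: nearest_point_uniq.
Qed.

Lemma projP x : nearest_point C x (Defs.proj C x).
Proof. by apply: xgetPex; exact: nearest_point_ex. Qed.

Hypothesis C_cone : is_cone C.

(** Only positive scalings are available, so the origin is reached as the limit of y/(k+1). *)
Lemma closed_cone0 : C 0.
Proof.
have [y Cy] := C_nonempty.
rewrite -(scale0r y).
apply: (closed_cvg (F := \oo) (u_ := fun k : nat => k.+1%:R^-1 *: y) C C_closed).
  by apply: nearW => k; apply: C_cone; rewrite // invr_gt0.
by apply: cvgZr_tmp; exact: cvg_harmonic.
Qed.

(** Moreau's decomposition. Testing the obtuse-angle inequality at 2y and y/2 gives orthogonality;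
    the inequality then becomes the dual-cone condition. *)
Lemma proj_moreau x :
  [/\ C (Defs.proj C x), dual_cone C (Defs.proj C x - x)
    & dot (Defs.proj C x) (Defs.proj C x - x) = 0].
Proof.
have xy := projP x; set y := Defs.proj C x in xy *.
have Cy : C y by case: xy.
have orth : dot y (y - x) = 0.
  have h2 := nearest_point_obtuse xy (C_cone (ltr0Sn R 1) Cy).
  have h0 := nearest_point_obtuse xy (C_cone (_ : 0 < 2^-1) Cy).
  have {}h0 := h0 ltac:(by rewrite invr_gt0).
  by move: h0 h2; rewrite !dot_linE (dotC x y); lra.
split => // z Cz.
have := nearest_point_obtuse xy Cz.
by move: orth; rewrite !dot_linE (dotC x y); lra.
Qed.

End NearestPoint.

(** * The operator Q and its resolvent *)

Section Vec.
Context {R : realType} {d : nat}.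
Implicit Types (z : 'cV[R]_d) (t : R) (x y : 'cV[R]_(d + 1)).

Lemma zpart_vec z t : zpart (vec z t) = z.
Proof. exact: col_mxKu. Qed.

Lemma tpart_vec z t : tpart (vec z t) = t.
Proof. by rewrite /tpart col_mxKd mxE eqxx. Qed.

Lemma vec_part x : vec (zpart x) (tpart x) = x.
Proof. by rewrite /vec /zpart /tpart -mx11_scalar vsubmxK. Qed.

Lemma zpartD x y : zpart (x + y) = zpart x + zpart y.
Proof. exact: linearD. Qed.

Lemma tpartD x y : tpart (x + y) = tpart x + tpart y.
Proof. by rewrite /tpart linearD mxE. Qed.

Lemma zpartN x : zpart (- x) = - zpart x.
Proof. exact: linearN. Qed.

Lemma tpartN x : tpart (- x) = - tpart x.
Proof. by rewrite /tpart linearN mxE. Qed.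

Lemma zpartZ t x : zpart (t *: x) = t *: zpart x.
Proof. exact: linearZ. Qed.

Lemma tpartZ t x : tpart (t *: x) = t * tpart x.
Proof. by rewrite /tpart linearZ mxE. Qed.

Lemma dot_parts x y : dot x y = dot (zpart x) (zpart y) + tpart x * tpart y.
Proof.
rewrite -[in LHS](vec_part x) -[in LHS](vec_part y) /vec {1}/dot.
rewrite tr_col_mx mul_row_col mxE; congr (_ + _).
by rewrite tr_scalar_mx -scalar_mxM mxE eqxx.
Qed.

Lemma part_eq x y : zpart x = zpart y -> tpart x = tpart y -> x = y.
Proof. by move=> zxy txy; rewrite -(vec_part x) -(vec_part y) zxy txy. Qed.

Definition partE := (zpart_vec, tpart_vec, zpartD, tpartD, zpartN, tpartN,
                     zpartZ, tpartZ).

End Vec.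

(** * Positive semidefinite quadratic forms *)

Section Psd.
Context {R : realType} {d : nat}.
Variable M : 'M[R]_d.
Hypothesis hM : psdmx (M + M^T).
Implicit Types x y : 'cV[R]_d.

Lemma psd_quad_ge0 x : 0 <= dot x (M *m x).
Proof.
have := hM.2 x.
by rewrite mulmxDl dotDr (dot_mulmxr M^T) trmxK (dotC (M *m x)); lra.
Qed.

(* The kernel of M + M^T is the null cone of its quadratic form. *)
Lemma psd_quad_eq0 x y :
  dot x (M *m x) = 0 -> dot x (M *m y) + dot y (M *m x) = 0.
Proof.
move=> fx0; set B := _ + _; apply/eqP/negPn/negP => B0.
(* Along [t *: x + y] the form is affine in t with slope [B]; this t gives it the value -1. *)
have := psd_quad_ge0 (- ((dot y (M *m y) + 1) / B) *: x + y).
rewrite mulmxDr -scalemxAr !dot_linE fx0.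
set t := - (_ / _).
have -> : t * (t * 0) + t * dot x (M *m y) +
    (t * dot y (M *m x) + dot y (M *m y)) = t * B + dot y (M *m y).
  by rewrite /B; ring.
have -> : t * B = - (dot y (M *m y) + 1) by rewrite /t mulNr divfK.
lra.
Qed.

(** A left null vector v gives |v|^2 + v M v^T = 0, a sum of two nonnegative terms. *)
Lemma psd_add1_unitmx : 1%:M + M \in unitmx.
Proof.
rewrite unitmxE unitfE; apply/negP => /det0P[v v0 vM].
move/negP: v0; apply; rewrite -(inj_eq trmx_inj) trmx0; apply/eqP/dot_le0_eq0.
have := psd_quad_ge0 v^T.
have : dot v^T v^T + dot v^T (M *m v^T) = 0.
  rewrite -dotDr -[X in X + _]mul1mx -mulmxDl /dot trmxK mulmxA vM mul0mx.
  by rewrite mxE.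
lra.
Qed.

End Psd.

(** * Monotonicity of Q and its explicit resolvent *)

Section Operator.
Context {R : realType} {d : nat}.
Variables (M : 'M[R]_d) (q : 'cV[R]_d).
Hypothesis hM : psdmx (M + M^T).
Implicit Types w x y s : 'cV[R]_(d + 1).

(** Write f(z) = z^T M z. With both scales positive the product is t t' f(z/t - z'/t'); with both
    zero it is f(z - z'). In the mixed case [psd_quad_eq0] removes the cross terms, and t(-z'^T q -
    kappa) >= 0 remains. *)
Lemma Qop_monotone x y s s' :
  Qop M q x s -> Qop M q y s' -> 0 <= dot (x - y) (s - s').
Proof.
have mixed x1 x2 s1 s2 : 0 < tpart x1 ->
    s1 = vec (M *m zpart x1 + tpart x1 *: q)
             (- dot (zpart x1) (M *m zpart x1) / tpart x1 - dot (zpart x1) q) ->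
    tpart x2 = 0 -> dot (zpart x2) (M *m zpart x2) = 0 ->
    (exists2 kappa, kappa <= - dot (zpart x2) q &
                    s2 = vec (M *m zpart x2) kappa) ->
    0 <= dot (x1 - x2) (s1 - s2).
  move=> t0 -> t20 f0 [k kq ->].
  have n0 := psd_quad_eq0 hM (zpart x1) f0.
  rewrite dot_parts !partE t20; set t := tpart x1 in t0 *.
  set z := zpart x1 in n0 *; set z' := zpart x2 in f0 kq n0 *.
  have tn0 : t != 0 by rewrite gt_eqF.
  have : 0 <= t * (- dot z' q - k) by rewrite mulr_ge0 ?(ltW t0) ?subr_ge0.
  rewrite !dot_linE f0.
  have -> : (t - 0) * (- dot z (M *m z) / t - dot z q - k) =
      - dot z (M *m z) - t * (dot z q + k). by field.
  lra.
move=> [[t0 sE]|[t0 f0 kE]] [[t0' s'E]|[t0' f0' kE']]; last first.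
- rewrite dot_parts !partE t0 t0' subrr mul0r addr0.
  case: kE kE' => k _ -> [k' _ ->]; rewrite !partE -mulmxBr.
  exact: psd_quad_ge0.
- rewrite -(opprB y x) -(opprB s' s) dotNl dotNr opprK.
  exact: mixed kE.
- exact: mixed kE'.
rewrite dot_parts sE s'E !partE.
set t := tpart x in t0 *; set t' := tpart y in t0' *.
set z := zpart x; set z' := zpart y.
have := psd_quad_ge0 hM (t^-1 *: z - t'^-1 *: z').
move=> /(mulr_ge0 (ltW (mulr_gt0 t0 t0'))).
rewrite mulmxBr -!scalemxAr !dot_linE; congr (0 <= _).
by field; rewrite (gt_eqF t0) (gt_eqF t0').
Qed.

(** Expand |e + g|^2 and use <e, g> >= 0. Uniqueness and continuity of the resolvent both follow
    from this bound. *)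
Lemma resolvent_Qop_le x y w w' :
  resolvent (Qop M q) w x -> resolvent (Qop M q) w' y ->
  enorm (x - y) <= enorm (w - w').
Proof.
move=> [s Qx ->] [s' Qy ->]; rewrite enorm_le.
have := Qop_monotone Qx Qy; have := dot_ge0 (s - s').
have -> : x + s - (y + s') = (x - y) + (s - s') by rewrite opprD addrACA.
move: (x - y) (s - s') => e g.
by rewrite !dot_linE (dotC g e); lra.
Qed.

Lemma resolvent_Qop_uniq w x y :
  resolvent (Qop M q) w x -> resolvent (Qop M q) w y -> x = y.
Proof.
move=> wx wy; apply/subr0_eq/dot_le0_eq0.
have := resolvent_Qop_le wx wy.
by rewrite subrr enorm_le dot0l.
Qed.

Lemma pvecE mu : pvec M mu + M *m pvec M mu = mu.
Proof. by rewrite -[X in X + _]mul1mx -mulmxDl mulKVmx ?psd_add1_unitmx. Qed.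

Lemma acoef_gt0 : 0 < acoef M q.
Proof. by rewrite ltr_pwDl ?dot_ge0. Qed.

(** Substituting mu = p + M p reveals that the constant coefficient is nonpositive. *)
Lemma ccoefE mu : ccoef M mu = - dot (pvec M mu) (M *m pvec M mu).
Proof. by rewrite /ccoef -{3}(pvecE mu) opprD addNKr dotNr. Qed.

Lemma bcoefE mu eta :
  bcoef M q mu eta = dot (rvec M q) (M *m pvec M mu)
                     - dot (rvec M q) (pvec M mu) - eta.
Proof. by rewrite /bcoef -{1}(pvecE mu) dotDr; ring. Qed.

Lemma sqr_bcoef_le_discr w : bcoef M q (zpart w) (tpart w) ^+ 2 <= discr M q w.
Proof.
rewrite /discr ccoefE mulrN opprK lerDl mulr_ge0 ?psd_quad_ge0 //.
by rewrite mulr_ge0 // ltW ?acoef_gt0.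
Qed.

Lemma discr_ge0 w : 0 <= discr M q w.
Proof. exact: le_trans (sqr_ge0 _) (sqr_bcoef_le_discr w). Qed.

(** Since q = r + M r, the vector part of the inclusion holds whatever tau is; for tau > 0 the
    scalar part, multiplied by tau, is the quadratic equation. *)
Lemma utilde_next_resolvent w : resolvent (Qop M q) w (utilde_next M q w).
Proof.
exists (w - utilde_next M q w); last by rewrite addrC subrK.
rewrite /utilde_next; set tau := _ / _.
have a0 := acoef_gt0; have discr0 := discr_ge0 w.
have bsq := sqr_bcoef_le_discr w.
have sq : Num.sqrt (discr M q w) ^+ 2 = discr M q w by rewrite sqr_sqrtr.
have sq0 : 0 <= Num.sqrt (discr M q w) by exact: sqrtr_ge0.
(* The square root dominates |b|, so the larger root is nonnegative. *)
have b_le : bcoef M q (zpart w) (tpart w) <= Num.sqrt (discr M q w).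
  by rewrite (le_trans (ler_norm _)) // -sqrtr_sqr ler_sqrt.
have tau0 : 0 <= tau.
  by rewrite divr_ge0 ?mulr_ge0 ?(ltW a0) // addrC subr_ge0.
have tauE : 2 * acoef M q * tau + bcoef M q (zpart w) (tpart w) =
    Num.sqrt (discr M q w).
  by rewrite /tau mulrC divfK ?mulf_neq0 ?gt_eqF // addrC addNKr.
(* Square 2 a tau + b = sqrt(discr) and divide by 4a. *)
have root : acoef M q * tau ^+ 2 + bcoef M q (zpart w) (tpart w) * tau
    + ccoef M (zpart w) = 0.
  apply: (@mulfI _ (4 * acoef M q)); first by rewrite mulf_neq0 ?gt_eqF.
  move: sq; rewrite -tauE /discr mulr0 => /eqP; rewrite -subr_eq0 => /eqP <-.
  by ring.
have muE := pvecE (zpart w).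
have qE : rvec M q + M *m rvec M q = q := pvecE q.
move: root; rewrite ccoefE /acoef; move: sq0; rewrite -tauE bcoefE.
set p := pvec M (zpart w) in muE *; set r := rvec M q in qE *.
rewrite /Qop !partE => b_ge0 root.
have zE : zpart w - (p - tau *: r) = M *m p + tau *: r.
  by rewrite -[in LHS]muE; apply/colP => i; rewrite !mxE; ring.
have [tau_gt0|tau_le0] := ltP 0 tau.
  left; split => //; apply: part_eq; rewrite !partE.
    rewrite zE mulmxBr -scalemxAr -qE scalerDr.
    by rewrite [_ *: r + _]addrC addrA subrK.
  have fq : tau * (tpart w - tau) = - dot (p - tau *: r) (M *m (p - tau *: r))
      - tau * dot (p - tau *: r) q.
    rewrite -qE mulmxBr -!scalemxAr !dot_linE.
    by move: root; rewrite (dotC r p); lra.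
  have taun0 : tau != 0 by rewrite gt_eqF.
  by apply: (mulfI taun0); rewrite fq; field.
(* At tau = 0 the equation reduces to p^T M p = 0, and b equals the square root, so b >= 0;
   [psd_quad_eq0] turns this into the bound on kappa. *)
have tauz : tau = 0 by apply/eqP; rewrite eq_le tau_le0.
move: root b_ge0; rewrite tauz expr0n !mulr0 !add0r => /eqP.
rewrite oppr_eq0 => /eqP fp.
have n0 := psd_quad_eq0 hM r fp => b_ge0.
right; split => //; first by rewrite scale0r subr0.
exists (tpart w); last first.
  by apply: part_eq; rewrite !partE ?subr0 // scale0r subr0 -muE addrC addKr.
rewrite scale0r subr0 -qE dotDr.
by move: b_ge0 n0; rewrite (dotC r p); lra.
Qed.

End Operator.

(** * Fejer monotone sequences *)

Section Fejer.
Context {R : realType} {n : nat}.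
Implicit Types (w : nat -> 'cV[R]_n) (p : 'cV[R]_n).

Lemma enorm0 : enorm (0 : 'cV[R]_n) = 0.
Proof. by rewrite /enorm dot0l sqrtr0. Qed.

Lemma enorm_sub_cvg w p :
  enorm (w k - p) @[k --> \oo] --> (0 : R) -> w @ \oo --> p.
Proof.
move=> /enorm_cvg0 h.
rewrite (_ : w = fun k => (w k - p) + p); last first.
  by apply/funext => k; rewrite subrK.
by rewrite -[X in _ --> X]add0r; apply: cvgD => //; exact: cvg_cst.
Qed.

Lemma cvg_enorm_sub w p :
  w @ \oo --> p -> enorm (w k - p) @[k --> \oo] --> (0 : R).
Proof.
move=> wp; have := cvg_enorm (cvgB wp (cvg_cst p)).
by rewrite subrr enorm0; exact.
Qed.

Lemma cvg_subseq {T : topologicalType} (w : nat -> T) (f : nat -> nat) (p : T) :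
  (forall j, (j <= f j)%N) -> w @ \oo --> p -> (w \o f) @ \oo --> p.
Proof.
move=> fj wp; apply: cvg_comp wp => A [N _ NA].
by exists N => // j /= Nj; apply: NA; rewrite /= (leq_trans Nj).
Qed.

(** Distances to [p] never increase, so closeness at the single index [f N] persists at all later
    indices. *)
Lemma fejer_cvg w p (f : nat -> nat) :
  (forall k, enorm (w k.+1 - p) <= enorm (w k - p)) ->
  (w \o f) @ \oo --> p -> w @ \oo --> p.
Proof.
move=> wfej wf; apply: enorm_sub_cvg.
have wmono i j : (i <= j)%N -> enorm (w j - p) <= enorm (w i - p).
  move=> /subnK <-; elim: (j - i)%N => // m; rewrite addSn; exact: le_trans.
apply/cvgrPdist_lt => e e0.
have /cvgrPdist_lt /(_ e e0) [N _ /(_ N (leqnn N))] := cvg_enorm_sub wf.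
rewrite /= sub0r normrN ger0_norm ?sqrtr_ge0 // => lt_e.
exists (f N) => // k /= fNk; rewrite sub0r normrN ger0_norm ?sqrtr_ge0 //.
exact: le_lt_trans (wmono _ _ fNk) lt_e.
Qed.

(** The squared norms decrease to a limit, so their consecutive differences, which bound |e k|^2,
    tend to 0. *)
Lemma fejer_increment_cvg0 w (e : nat -> 'cV[R]_n) :
  (forall k, dot (w k.+1) (w k.+1) + dot (e k) (e k) <= dot (w k) (w k)) ->
  enorm (e k) @[k --> \oo] --> (0 : R).
Proof.
move=> we.
pose g k := dot (w k) (w k).
have g_cvg : cvg (g @ \oo).
  apply: nonincreasing_is_cvgn; last by exists 0 => _ [k _ <-]; exact: dot_ge0.
  apply/nonincreasing_seqP => k.
  by apply: le_trans (we k); rewrite lerDl dot_ge0.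
have diff0 : g k - g k.+1 @[k --> \oo] --> (0 : R).
  rewrite -(subrr (lim (g @ \oo))); apply: cvgB => //.
  by rewrite cvg_shiftS.
have dot0 : dot (e k) (e k) @[k --> \oo] --> (0 : R).
  apply: (squeeze_cvgr _ (cvg_cst 0) diff0).
  apply: nearW => k; rewrite dot_ge0 /= /g.
  by have := we k; lra.
rewrite -(@sqrtr0 R).
exact: (cvg_comp _ _ dot0 (@sqrt_continuous R 0)).
Qed.

End Fejer.

(** * The product cone, its dual, and passage to the limit *)

Section ConePlus.
Context {R : realType} {d : nat}.
Implicit Types (C : set 'cV[R]_d) (x y : 'cV[R]_(d + 1)).

Lemma dual_cone_plus_ge0 C x y :
  cone_plus C x -> cone_plus (dual_cone C) y -> 0 <= dot x y.
Proof.
move=> [Cx x0] [Cy y0]; rewrite dot_parts addr_ge0 ?mulr_ge0 //.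
by rewrite dotC; exact: Cy.
Qed.

Lemma enorm_zpart_le x : enorm (zpart x) <= enorm x.
Proof. by rewrite /enorm ler_sqrt ?dot_ge0 // (dot_parts x) lerDl -expr2 sqr_ge0. Qed.

Lemma cvg_zpart (x : nat -> 'cV[R]_(d + 1)) a :
  x @ \oo --> a -> zpart (x k) @[k --> \oo] --> zpart a.
Proof.
move=> xa; apply: enorm_sub_cvg.
apply: (squeeze_cvgr _ (cvg_cst 0) (cvg_enorm_sub xa)).
apply: nearW => k; rewrite sqrtr_ge0 /= -zpartN -zpartD.
exact: enorm_zpart_le.
Qed.

Lemma cvg_tpart (x : nat -> 'cV[R]_(d + 1)) a :
  x @ \oo --> a -> tpart (x k) @[k --> \oo] --> tpart a.
Proof.
have tE y : tpart y = dot y (vec 0 1).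
  by rewrite dot_parts !partE dot0r add0r mulr1.
move=> xa; rewrite tE; under eq_fun do rewrite tE.
by apply: cvg_dot => //; exact: cvg_cst.
Qed.

Lemma cvg_ge0 (x : nat -> R) a :
  (forall k, 0 <= x k) -> x @ \oo --> a -> 0 <= a.
Proof.
move=> x0; apply: (@closed_cvg _ _ \oo _ x [set t | 0 <= t]).
  exact: closed_ge.
exact: nearW.
Qed.

Lemma cone_plus_cvg C (x : nat -> 'cV[R]_(d + 1)) a :
  closed C -> (forall k, cone_plus C (x k)) -> x @ \oo --> a -> cone_plus C a.
Proof.
move=> Ccl Cx xa; split.
  apply: (closed_cvg C Ccl _ _ (cvg_zpart xa)).
  by apply: nearW => k; case: (Cx k).
by apply: cvg_ge0 (cvg_tpart xa) => k; case: (Cx k).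
Qed.

(** An intersection of closed half-spaces. *)
Lemma dual_cone_closed C : closed (dual_cone C).
Proof.
rewrite (_ : dual_cone C = \bigcap_(z in C) [set w | 0 <= dot w z]).
  apply: closed_bigI => z Cz.
  apply: (preimage_closed (f := fun w : 'cV[R]_d => dot w z)
                          (D := [set t : R | 0 <= t])).
    move=> w _; apply: (@cvg_dot _ _ _ (nbhs w) _ id (fun=> z) w z).
      exact: cvg_id.
    exact: cvg_cst.
  exact: closed_ge.
by [].
Qed.

End ConePlus.

(** * The splitting iteration *)

Section Splitting.
Context {R : realType} {d : nat}.
Variables (M : 'M[R]_d) (q : 'cV[R]_d) (C : set 'cV[R]_d).
Hypothesis hM : psdmx (M + M^T).
Hypotheses (C_nonempty : C !=set0) (C_closed : closed C).
Hypotheses (C_convex : convex_set C) (C_cone : is_cone C).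
Implicit Types w us vs : 'cV[R]_(d + 1).

(** Solutions of the homogeneous embedding of the LCP; by [splitting_fejer], [us + vs] is then a
    fixed point of [w_next]. *)
Definition embedding_solution us vs : Prop :=
  [/\ Qop M q us vs, cone_plus C us, cone_plus (dual_cone C) vs
    & dot us vs = 0].

(** At [wseq k] this is [vseq k.+1]: the residual of projecting 2 utilde - w onto the product
    cone. *)
Definition v_next w := u_next M q C w + w - 2 *: utilde_next M q w.

(** Moreau's decomposition in [C], paired with its scalar analogue: max(0, s) and max(0, s) - s are
    nonnegative with product 0. *)
Lemma u_next_moreau w :
  [/\ cone_plus C (u_next M q C w), cone_plus (dual_cone C) (v_next w)
    & dot (u_next M q C w) (v_next w) = 0].
Proof.
have [Cz Cdz orth] := proj_moreau C_convex C_nonempty C_closed C_cone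
  (2 *: zpart (utilde_next M q w) - zpart w).
have uzE : zpart (u_next M q C w) =
    Defs.proj C (2 *: zpart (utilde_next M q w) - zpart w).
  exact: zpart_vec.
have utE : tpart (u_next M q C w) =
    Num.max 0 (2 * tpart (utilde_next M q w) - tpart w).
  exact: tpart_vec.
have vzE : zpart (v_next w) = zpart (u_next M q C w)
    - (2 *: zpart (utilde_next M q w) - zpart w).
  by rewrite !(zpartD, zpartN, zpartZ) opprB addrA.
have vtE : tpart (v_next w) = tpart (u_next M q C w)
    - (2 * tpart (utilde_next M q w) - tpart w).
  by rewrite !(tpartD, tpartN, tpartZ) opprB addrA.
split; first by split; rewrite ?uzE ?utE // le_max lexx.
  by split; rewrite ?vzE ?vtE ?uzE ?utE // subr_ge0 le_max lexx orbT.
rewrite dot_parts vzE vtE uzE utE orth add0r.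
by case: leP => _; rewrite ?mul0r // subrr mulr0.
Qed.

(* With s = w - utilde and v = u - utilde + s, the successor of w is
   u + s = utilde + v; hence |w - w*|^2 - |w' - w*|^2 - |u - utilde|^2 equals
   2 <utilde - us, s - vs> - 2 <u - us, v - vs>, where w* = us + vs. *)
Lemma splitting_fejer w us vs : embedding_solution us vs ->
  dot (w_next M q C w - (us + vs)) (w_next M q C w - (us + vs))
    + dot (u_next M q C w - utilde_next M q w)
          (u_next M q C w - utilde_next M q w)
  <= dot (w - (us + vs)) (w - (us + vs)).
Proof.
move=> [Qs Cus Cvs usvs].
have [Cu Cv uv] := u_next_moreau w.
have [s Qu wE] := utilde_next_resolvent q hM w.
have mono := Qop_monotone hM Qu Qs.
have us_v := dual_cone_plus_ge0 Cus Cv.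
have u_vs := dual_cone_plus_ge0 Cu Cvs.
move: uv us_v; rewrite /v_next /w_next.
move: Qu mono u_vs wE; set ut := utilde_next M q w; set u := u_next M q C w.
move=> _; move: ut u s => ut u s mono u_vs ->.
have -> : u + (ut + s) - 2 *: ut = u - ut + s.
  by apply/colP => i; rewrite !mxE; ring.
have -> : ut + s + u - ut = s + u.
  by apply/colP => i; rewrite !mxE; ring.
(* As <u, v> and <us, vs> vanish, -<u - us, v - vs> equals <u, vs> + <us, v>, both nonnegative. *)
move: mono u_vs; rewrite !dot_linE.
rewrite ?(dotC s ut, dotC u ut, dotC us ut, dotC vs ut, dotC us u, dotC vs u,
  dotC u s, dotC us s, dotC vs s, dotC vs us) usvs.
lra.
Qed.

Lemma embedding_solution0 : embedding_solution 0 0.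
Proof.
have C0 := closed_cone0 C_nonempty C_closed C_cone.
have z0 : zpart (0 : 'cV[R]_(d + 1)) = 0 by rewrite -(scale0r 0) zpartZ scale0r.
have t0 : tpart (0 : 'cV[R]_(d + 1)) = 0 by rewrite -(scale0r 0) tpartZ mul0r.
split; rewrite ?dot0l //.
- right; split; rewrite ?z0 ?dot0l //; exists 0; rewrite ?oppr0 //.
  by apply: part_eq; rewrite !partE ?z0 ?t0 // mulmx0.
- by split; rewrite ?z0 ?t0.
- by split; rewrite ?z0 ?t0 // => z _; rewrite dot0l.
Qed.

(** The vector and scalar terms of [dot us vs] are nonnegative with sum 0. *)
Lemma embedding_solution_exclusive us vs :
  embedding_solution us vs -> ~ (0 < tpart us /\ 0 < tpart vs).
Proof.
move=> [_ [Cz _] [Cdz _]]; rewrite dot_parts => uv [tu tv].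
have := Cdz _ Cz; rewrite dotC.
by have := mulr_gt0 tu tv; lra.
Qed.

(** Exclusivity makes kappa zero, so complementarity holds between the vector parts alone, and
    everything scales by 1/tau. *)
Lemma embedding_solution_lcp us vs : embedding_solution us vs ->
  0 < tpart us -> lcp_solution M q C ((tpart us)^-1 *: zpart us).
Proof.
move=> sol tu.
have tv : tpart vs = 0.
  apply/eqP; rewrite eq_le; case: (sol) => _ _ [_ ->] _; rewrite andbT leNgt.
  by apply/negP => tv; apply: (embedding_solution_exclusive sol).
case: sol => Qs [Cz _] [Cdz _]; rewrite dot_parts tv mulr0 addr0 => uv.
have vz : zpart vs = M *m zpart us + tpart us *: q.
  by case: Qs => [[_ ->]|[t0 _ _]]; [rewrite zpart_vec | rewrite t0 ltxx in tu].
have qE : M *m ((tpart us)^-1 *: zpart us) + q = (tpart us)^-1 *: zpart vs.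
  by rewrite vz -scalemxAr scalerDr scalerA mulVf ?scale1r ?gt_eqF.
have ti : 0 < (tpart us)^-1 by rewrite invr_gt0.
split; first exact: C_cone.
  by move=> z Cz'; rewrite qE dotZl mulr_ge0 ?(ltW ti) //; exact: Cdz.
by rewrite qE dotZl dotZr uv !mulr0.
Qed.

(** Exclusivity puts [us] in the branch tau = 0 of Q, where 0 < kappa <= -z^T q. *)
Lemma embedding_solution_infeasible us vs : embedding_solution us vs ->
  0 < tpart vs -> lcp_infeasibility_certificate M q C (zpart us).
Proof.
move=> sol tv.
have tu : tpart us = 0.
  apply/eqP; rewrite eq_le; case: (sol) => _ [_ ->] _ _; rewrite andbT leNgt.
  by apply/negP => tu; apply: (embedding_solution_exclusive sol).
case: sol => Qs [Cz _] [Cdz _] _.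
case: Qs => [[]|[_ fz [k kq vE]]]; first by rewrite tu ltxx.
move: tv Cdz; rewrite vE !partE => k0 Cdz.
by split => //; lra.
Qed.

(** Take tau = 1 and kappa = 0; complementarity makes the scalar component of Q vanish. *)
Lemma lcp_solution_embedding z : lcp_solution M q C z ->
  embedding_solution (vec z 1) (vec (M *m z + q) 0).
Proof.
move=> [Cz Cdz orth]; split.
- left; rewrite !partE scale1r divr1; split => //; congr vec.
  by move: orth; rewrite dotDr; lra.
- by split; rewrite !partE.
- by split; rewrite !partE.
- by rewrite dot_parts !partE orth mulr0 addr0.
Qed.

(** Take tau = 0 and for kappa the largest admissible value, which is positive. *)
Lemma certificate_embedding l : lcp_infeasibility_certificate M q C l ->
  embedding_solution (vec l 0) (vec (M *m l) (- dot l q)).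
Proof.
move=> [Cl Cdl fl lq]; split.
- by right; rewrite !partE; split => //; exists (- dot l q).
- by split; rewrite !partE.
- by split; rewrite !partE // oppr_ge0 ltW.
- by rewrite dot_parts !partE fl mul0r addr0.
Qed.

(** Q is homogeneous of degree one under positive scaling, and the other conditions are conic. *)
Lemma embedding_solutionZ (t : R) us vs : 0 < t ->
  embedding_solution us vs -> embedding_solution (t *: us) (t *: vs).
Proof.
move=> t0 [Qs [Cz u0] [Cdz v0] uv].
have tn0 : t != 0 by rewrite gt_eqF.
split.
- case: Qs => [[tu ->]|[tu fz [k kq ->]]].
    left; rewrite !partE; split; first exact: mulr_gt0.
    have tun0 : tpart us != 0 by rewrite gt_eqF.
    apply: part_eq; rewrite !partE; first by rewrite -scalemxAr scalerDr scalerA.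
    by rewrite -!scalemxAr !dot_linE; field; rewrite tun0.
  right; rewrite !partE tu mulr0 -!scalemxAr !dot_linE fz !mulr0; split => //.
  exists (t * k); first by rewrite -mulrN ler_pM2l.
  by apply: part_eq; rewrite !partE.
- by split; rewrite !partE ?mulr_ge0 ?(ltW t0) //; exact: C_cone.
- split; rewrite !partE ?mulr_ge0 ?(ltW t0) //.
  by move=> z Cz'; rewrite dotZl mulr_ge0 ?(ltW t0) //; exact: Cdz.
- by rewrite !dot_linE uv !mulr0.
Qed.

(** * Convergence of the iterates and their distance from the origin *)

Variable w0 : 'cV[R]_(d + 1).
Let w := wseq M q C w0.

Lemma wseqS k : w k.+1 = w_next M q C (w k).
Proof. exact: iterS. Qed.

Lemma wseq_fejer us vs k : embedding_solution us vs ->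
  enorm (w k.+1 - (us + vs)) <= enorm (w k - (us + vs)).
Proof.
move=> sol; rewrite enorm_le wseqS.
by apply: le_trans (splitting_fejer (w k) sol); rewrite lerDl dot_ge0.
Qed.

Lemma wseq_fejer0 us vs k : embedding_solution us vs ->
  enorm (w k - (us + vs)) <= enorm (w0 - (us + vs)).
Proof. by move=> sol; elim: k => // k; apply/le_trans/wseq_fejer. Qed.

Lemma wseq_increment_cvg0 :
  enorm (u_next M q C (w k) - utilde_next M q (w k)) @[k --> \oo] --> (0 : R).
Proof.
apply: (fejer_increment_cvg0 (w := w)) => k.
have := splitting_fejer (w k) embedding_solution0.
by rewrite addr0 !subr0 wseqS.
Qed.

(** Continuity comes from nonexpansiveness of the resolvent, not from the explicit formula. *)
Lemma utilde_next_cvg (x : nat -> 'cV[R]_(d + 1)) p : x @ \oo --> p ->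
  utilde_next M q (x k) @[k --> \oo] --> utilde_next M q p.
Proof.
move=> xp; apply: enorm_sub_cvg.
apply: (squeeze_cvgr _ (cvg_cst 0) (cvg_enorm_sub xp)).
apply: nearW => k; rewrite sqrtr_ge0 /=.
exact: resolvent_Qop_le (utilde_next_resolvent _ _ _) (utilde_next_resolvent _ _ _).
Qed.

(** Stated along [f] for two uses: the subsequence that yields a cluster point, and the identity
    once the whole sequence converges. *)
Lemma iterates_cvg (f : nat -> nat) p :
  (forall j, (j <= f j)%N) -> (w \o f) @ \oo --> p ->
  [/\ utilde_next M q (w (f j)) @[j --> \oo] --> utilde_next M q p,
      u_next M q C (w (f j)) @[j --> \oo] --> utilde_next M q p
    & v_next (w (f j)) @[j --> \oo] --> p - utilde_next M q p].
Proof.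
move=> fj wp; have utp := utilde_next_cvg wp.
have incr := cvg_subseq fj
  (@enorm_cvg0 _ _ _ \oo eventually_filter _ wseq_increment_cvg0).
have up : u_next M q C (w (f j)) @[j --> \oo] --> utilde_next M q p.
  have uE j : u_next M q C (w (f j)) = (u_next M q C (w (f j))
      - utilde_next M q (w (f j))) + utilde_next M q (w (f j)).
    by rewrite subrK.
  rewrite (funext uE).
  by rewrite -[X in _ --> X]add0r; exact: cvgD incr utp.
split; [exact: utp|exact: up|].
have -> : p - utilde_next M q p =
    utilde_next M q p + p - 2 *: utilde_next M q p.
  by apply/colP => i; rewrite !mxE; ring.
by apply: cvgB; [exact: cvgD|exact: cvgZl_tmp].
Qed.

(** Membership in Q is the resolvent inclusion at [p] itself; the cone and orthogonality conditions
    are limits of those in [u_next_moreau]. *)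
Lemma cluster_embedding_solution (f : nat -> nat) p :
  (forall j, (j <= f j)%N) -> (w \o f) @ \oo --> p ->
  embedding_solution (utilde_next M q p) (p - utilde_next M q p).
Proof.
move=> fj wp; have [utp up vp] := iterates_cvg fj wp.
have moreau j := u_next_moreau (w (f j)).
split.
- have [s Qs pE] := utilde_next_resolvent q hM p.
  by rewrite {2}pE addrC addKr.
- by apply: cone_plus_cvg up => // j; case: (moreau j).
- apply: cone_plus_cvg vp => [|j]; first exact: dual_cone_closed.
  by case: (moreau j).
- have := @cvg_dot _ _ _ \oo eventually_filter _ _ _ _ up vp.
  have uv0 j : dot (u_next M q C (w (f j))) (v_next (w (f j))) = 0.
    by case: (moreau j).
  rewrite (funext uv0) => dot0.
  by rewrite -(cvg_lim (@Rhausdorff R) dot0) lim_cst.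
Qed.

Lemma wseq_cvg : exists p : 'cV[R]_(d + 1), w @ \oo --> p.
Proof.
have bounded k : enorm (w k) <= enorm w0.
  by have := wseq_fejer0 k embedding_solution0; rewrite addr0 !subr0.
have [p [f [fj wp]]] := bounded_seq_subseq bounded.
exists p; apply: (fejer_cvg _ wp) => k.
(* The solution attached to [p] satisfies us + vs = p. *)
have := wseq_fejer k (cluster_embedding_solution fj wp).
by rewrite subrKC.
Qed.

(* The iterates are Fejer monotone towards t *: (us + vs) for every t > 0; let t
   go to infinity. *)
Lemma wseq_dot_ge us vs k : embedding_solution us vs ->
  dot w0 (us + vs) <= dot (w k) (us + vs).
Proof.
move=> sol; rewrite leNgt; apply/negP => lt_dot.
set D := dot w0 (us + vs) - dot (w k) (us + vs).
have D0 : 0 < D by rewrite subr_gt0.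
(* With this [t] the Fejer inequality reads |w k|^2 + |w0|^2 + 1 <= |w0|^2. *)
pose t := (dot w0 w0 + 1) / (2 * D).
have t0 : 0 < t by rewrite divr_gt0 ?mulr_gt0 // ltr_wpDl ?dot_ge0.
have tD : 2 * (t * D) = dot w0 w0 + 1.
  by rewrite mulrCA /t divfK // mulf_neq0 ?gt_eqF.
have := wseq_fejer0 k (embedding_solutionZ t0 sol).
rewrite -scalerDr enorm_le; move: tD; rewrite /D.
move: (us + vs) => s; rewrite !dot_linE (dotC s (w k)) (dotC s w0).
by have := dot_ge0 (w k); lra.
Qed.

(** By Cauchy-Schwarz, the lower bound on inner products divided by |us + vs| bounds every norm from
    below. *)
Lemma inf_enorm_wseq_gt0 us vs : embedding_solution us vs ->
  0 < dot w0 (us + vs) -> 0 < inf (range (fun k => enorm (w k))).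
Proof.
move=> sol dot_gt0.
have lower k : dot w0 (us + vs) <= enorm (w k) * enorm (us + vs).
  exact: le_trans (wseq_dot_ge k sol) (cauchy_schwarz _ _).
have s0 : 0 < enorm (us + vs).
  rewrite lt_def sqrtr_ge0 andbT; apply/eqP => s0.
  by have := lower 0%N; rewrite s0 mulr0 leNgt dot_gt0.
apply: (@lt_le_trans _ _ (dot w0 (us + vs) / enorm (us + vs))).
  exact: divr_gt0.
apply: lb_le_inf; first by exists (enorm (w 0%N)); exists 0%N.
by move=> _ [k _ <-]; rewrite ler_pdivrMr.
Qed.

End Splitting.

Theorem mainTheorem3 (R : realType) (d : nat) (hd : (1 <= d)%N)
    (M : 'M[R]_d) (hM : psdmx (M + M^T)) (q : 'cV[R]_d)
    (C : set 'cV[R]_d) (C_nonempty : C !=set0) (C_closed : closed C)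
    (C_convex : convex_set C) (C_cone : is_cone C) :
  (forall (mu0 : 'cV[R]_d) (eta0 : R), 0 < eta0 ->
    let w := wseq M q C (vec mu0 eta0) in
    let ut := utilde M q C (vec mu0 eta0) in
    let u := useq M q C (vec mu0 eta0) in
    let v := vseq M q C (vec mu0 eta0) in
    (* (i) *)
    [/\ 1%:M + M \in unitmx,
        forall x : 'cV[R]_d, exists! y, nearest_point C x y,
        forall k : nat, 0 <= discr M q (w k) &
        forall k : nat, resolvent (Qop M q) (w k) = [set ut k.+1]]
    (* (ii) *)
    /\ (forall k : nat, (1 <= k)%N ->
        [/\ cone_plus C (u k), cone_plus (dual_cone C) (v k) &
            dot (u k) (v k) = 0])
    (* (iii) *)
    /\ (exists us vs ws : 'cV[R]_(d + 1),
        [/\ u k @[k --> \oo] --> us,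
            v k @[k --> \oo] --> vs,
            w k @[k --> \oo] --> ws &
            enorm (u k - ut k) @[k --> \oo] --> (0 : R)]
        /\ [/\ Qop M q us vs,
               cone_plus C us,
               cone_plus (dual_cone C) vs &
               dot us vs = 0]
        /\ [/\ ~ (0 < tpart us /\ 0 < tpart vs),
               0 < tpart us ->
                 lcp_solution M q C ((tpart us)^-1 *: zpart us) &
               0 < tpart vs ->
                 lcp_infeasibility_certificate M q C (zpart us)]))
  (* (iv) *)
  /\ ((exists z, lcp_solution M q C z) \/
      (exists l, lcp_infeasibility_certificate M q C l) ->
      0 < inf (range (fun k : nat => enorm (wseq M q C (vec 0 1) k)))).
Proof.
split=> [mu0 eta0 _ /=|[[z sol]|[l cert]]].
- split; last split.
  + split; first exact: psd_add1_unitmx.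
    * exact: nearest_point_exu.
    * by move=> k; exact: discr_ge0.
    * move=> k; apply/seteqP; split => [y /= wy|_ ->].
        exact: resolvent_Qop_uniq wy (utilde_next_resolvent _ _ _).
      exact: utilde_next_resolvent.
  + by move=> k _; exact: u_next_moreau.
  + set w0 := vec mu0 eta0.
    have [p wp] := wseq_cvg q hM C_nonempty C_closed C_convex C_cone w0.
    have id_le (j : nat) : (j <= id j)%N by [].
    have [_ up vp] :=
      iterates_cvg hM C_nonempty C_closed C_convex C_cone id_le wp.
    have sol := cluster_embedding_solution
      hM C_nonempty C_closed C_convex C_cone id_le wp.
    exists (utilde_next M q p), (p - utilde_next M q p), p.
    split; last split.
    (* Index k+1 of [u], [v] and [ut] reads [wseq k], hence the shifts. *)
    * split; last by rewrite -cvg_shiftS; exact: wseq_increment_cvg0.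
      - by rewrite -cvg_shiftS; exact: up.
      - by rewrite -cvg_shiftS; exact: vp.
      - exact: wp.
    * exact: sol.
    * split; first exact: (embedding_solution_exclusive sol).
        exact: (embedding_solution_lcp C_cone sol).
      exact: (embedding_solution_infeasible sol).
- apply: (inf_enorm_wseq_gt0 hM C_nonempty C_closed C_convex C_cone
    (lcp_solution_embedding sol)).
  (* The inner product with (0, 1) is tau + kappa, here 1. *)
  by rewrite dot_parts !partE dot0l add0r addr0 mulr1.
- apply: (inf_enorm_wseq_gt0 hM C_nonempty C_closed C_convex C_cone
    (certificate_embedding cert)).
  (* Here tau + kappa is -l^T q. *)
  by case: cert => _ _ _ lq; rewrite dot_parts !partE dot0l !add0r mul1r oppr_gt0.
Qed.
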